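(* Let $N\ge1$, $0\le\alpha\le1/L$ and $0\le\beta\le2/L-\alpha$, and run the noisy algorithm with these constant parameters. Then $$\mathbb{E}f(\theta_N)-f(\theta_* )\le\min\Big\{\frac{\|\theta_0-\theta_*\|^2}{\alpha N^2}+\frac{(\alpha N+\beta)^2}{\alpha N}\operatorname{tr}(C),\ \frac{4\|\theta_0-\theta_*\|^2}{(\alpha+\beta)N}+\frac{4(\alpha N+\beta)^2}{\alpha+\beta}\operatorname{tr}(C)\Big\},$$ where a term with zero denominator is interpreted as $+\infty$.
   Context: Let $H\in\mathbb{R}^{d\times d}$ be symmetric positive definite with largest eigenvalue $L$, $q\in\mathbb{R}^d$, $f(\theta)=\frac12\langle\theta,H\theta\rangle-\langle q,\theta\rangle$, $\theta_*=H^{-1}q$. Let $(\varepsilon_n)_{n\ge2}$ be random vectors in $\mathbb{R}^d$ with $\mathbb{E}\varepsilon_n=0$, $\mathbb{E}[\varepsilon_n\varepsilon_m^\top]=0$ for $n\neq m$, and $\mathbb{E}[\varepsilon_n\varepsilon_n^\top]=C$ for all $n$, for a fixed positive semidefinite $C$. The noisy algorithm with parameters $\alpha,\beta$: given deterministic $\theta_0\in\mathbb{R}^d$, set $\theta_1=\theta_0$ and for $n\ge1$ $$\theta_{n+1}=\frac{2n}{n+1}\theta_n-\frac{n-1}{n+1}\theta_{n-1}-\frac{1}{n+1}\Big(n(\alpha+\beta)H(\theta_n-\theta_* )-(n-1)\beta H(\theta_{n-1}-\theta_* )-(n\alpha+\beta)\varepsilon_{n+1}\Big),$$ i.e. the gradient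 $f'(\omega_n)$, $\omega_n=\frac{n(\alpha+\beta)\theta_n-(n-1)\beta\theta_{n-1}}{n\alpha+\beta}$, in the recursion $\theta_{n+1}=\frac{2n}{n+1}\theta_n-\frac{n-1}{n+1}\theta_{n-1}-\frac{n\alpha+\beta}{n+1}f'(\omega_n)$ is replaced by $f'(\omega_n)-\varepsilon_{n+1}$. Equivalently, $\eta_n=n(\theta_n-\theta_* )$ satisfies $\eta_0=0$, $\eta_1=\theta_0-\theta_*$, $\eta_{n+1}=(I-\alpha H)\eta_n+(I-\beta H)(\eta_n-\eta_{n-1})+(n\alpha+\beta)\varepsilon_{n+1}$. *)

(* Defs.v *)
From HB Require Import structures.
From mathcomp Require Import all_boot all_order all_algebra.
Set Implicit Arguments. Unset Strict Implicit. Unset Printing Implicit Defensive.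
Import Order.TTheory GRing.Theory Num.Theory.
Local Open Scope ring_scope.

Section Defs.
Variables (R : rcfType) (d : nat).

Definition quadf (H : 'M[R]_d) (q theta : 'cV[R]_d) : R :=
  2^-1 * (theta^T *m H *m theta) 0 0 - (q^T *m theta) 0 0.

Definition thstar (H : 'M[R]_d) (q : 'cV[R]_d) : 'cV[R]_d := invmx H *m q.

Definition sqnorm (x : 'cV[R]_d) : R := \sum_i (x i 0) ^+ 2.

(* one step: given n >= 1, theta_n, theta_{n-1} and the noise e = eps_{n+1},
   returns theta_{n+1} *)
Definition noisy_step (H : 'M[R]_d) (ts : 'cV[R]_d) (alpha beta : R) (n : nat)
  (thn thn1 e : 'cV[R]_d) : 'cV[R]_d :=
  (2 * n%:R / n.+1%:R) *: thn - (n.-1%:R / n.+1%:R) *: thn1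
  - (n.+1%:R)^-1 *: ((n%:R * (alpha + beta)) *: (H *m (thn - ts))
                     - (n.-1%:R * beta) *: (H *m (thn1 - ts))
                     - (n%:R * alpha + beta) *: e).

(* noisy_pair ... n = (theta_n, theta_{n+1}), with theta_1 = theta_0 *)
Fixpoint noisy_pair (H : 'M[R]_d) (ts : 'cV[R]_d) (alpha beta : R)
  (eps : nat -> 'cV[R]_d) (theta0 : 'cV[R]_d) (n : nat) : 'cV[R]_d * 'cV[R]_d :=
  match n with
  | 0 => (theta0, theta0)
  | m.+1 => let p := noisy_pair H ts alpha beta eps theta0 m in
            (p.2, noisy_step H ts alpha beta m.+1 p.2 p.1 (eps m.+2))
  end.

Definition noisy_theta (H : 'M[R]_d) (q : 'cV[R]_d) (alpha beta : R)
  (eps : nat -> 'cV[R]_d) (theta0 : 'cV[R]_d) (n : nat) : 'cV[R]_d :=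
  (noisy_pair H (thstar H q) alpha beta eps theta0 n).1.

End Defs.

(* Main.v *)
Require Import Defs.
From HB Require Import structures.
From mathcomp Require Import all_boot all_order all_algebra.
From mathcomp Require Import ring lra complex.
From mathcomp Require Import boolp.
Set Implicit Arguments. Unset Strict Implicit. Unset Printing Implicit Defensive.
Import Order.TTheory GRing.Theory Num.Theory.
Local Open Scope ring_scope.

(* With eta_n = n (theta_n - theta_* ), the algorithm is the linear recurrence
   eta_{n+2} = p eta_{n+1} - q eta_n + noise, where p = 2 - (alpha + beta) H and
   q = 1 - beta H, so eta_N is a combination of theta_0 - theta_* and the noises
   with coefficients the Lucas polynomials U_n(p, q).  As the noise is centered
   and uncorrelated, E <eta_N, H eta_N> splits into one quadratic form per
   term, each controlled by a bound on h U_n^2 over the eigenvalues h of H.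
   With a = alpha h and b = beta h, explicit Lyapunov functions of the scalar
   recurrence give a U_n^2 <= 2 and (a + b) U_n^2 <= 8 n; the former is summed
   as such, the latter using n <= N. *)

(** * Scalar recurrence *)

(** Over an arbitrary ring, so that the same polynomials serve for scalars and for matrices. *)
Fixpoint lucas (S : pzRingType) (p q : S) (n : nat) : S :=
  if n is m.+1 then
    if m is k.+1 then p * lucas p q m - q * lucas p q k else 1
  else 0.

Arguments lucas : simpl never.

Lemma lucasSS (S : pzRingType) (p q : S) n :
  lucas p q n.+2 = p * lucas p q n.+1 - q * lucas p q n.
Proof. by []. Qed.

Lemma lucas_sqr_le (R : realFieldType) (a b : R) n :
  0 <= a -> a <= 1 -> 0 <= b -> a + b <= 2 ->
  a * lucas (2 - a - b) (1 - b) n ^+ 2 <= 2.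
Proof.
move=> a_ge0 a_le1 b_ge0 ab_le2; set u := lucas _ _.
have uSS m : u m.+2 = (2 - a - b) * u m.+1 - (1 - b) * u m by [].
(* Lyapunov function in x = u_n and z = u_{n+1} - (1 - b) u_n; for b = 0 it is
   the invariant quadratic form of the recurrence. *)
pose V x z := z ^+ 2 + a * (1 - b) * x * z + a * (1 - a * b + b / 2) * x ^+ 2.
have Vge x z : a / 2 * x ^+ 2 <= V x z.
  (* The right-hand side is what remains in front of [a * x ^+ 2] after completing the square in
     [z]. *)
  have coef : 2^-1 <= 1 - a * b + b / 2 - a * (1 - b) ^+ 2 / 4.
    have h : a * (1 + b) <= 2.
      have [b1|b1] := leP b 1.
        have : 0 <= b * (1 - a) by rewrite mulr_ge0 ?subr_ge0.
        lra.
      (* Here [a <= 2 - b], and [(2 - b) * (1 + b) = 2 - b * (b - 1)]. *)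
      have : 0 <= (2 - b - a) * (1 + b) by rewrite mulr_ge0; lra.
      have : 0 <= b * (b - 1) by rewrite mulr_ge0//; lra.
      lra.
    have -> : 1 - a * b + b / 2 - a * (1 - b) ^+ 2 / 4 =
      2^-1 + (1 + b) * (2 - a * (1 + b)) / 4 by field.
    by rewrite lerDl !mulr_ge0 ?invr_ge0 ?subr_ge0// addr_ge0.
  have -> : V x z = (z + a * (1 - b) / 2 * x) ^+ 2
     + a * (1 - a * b + b / 2 - a * (1 - b) ^+ 2 / 4) * x ^+ 2 by rewrite /V; field.
  rewrite -[leLHS]add0r lerD ?sqr_ge0// ler_wpM2r ?sqr_ge0//.
  by rewrite ler_wpM2l.
have Vle m : V (u m) (u m.+1 - (1 - b) * u m) <= 1.
  elim: m => [|m IH]; first by rewrite /V /u /lucas /=; nra.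
  apply: le_trans IH; rewrite uSS.
  set x := u m; set z := u m.+1 - _ * x.
  have -> : u m.+1 = (1 - b) * x + z by rewrite /z; ring.
  rewrite -subr_ge0 /V.
  (* The exact decrease of [V] over one step. *)
  rewrite [leRHS](_ : _ = a * b * (z ^+ 2 / 2
    + ((2 - a - b) + b * (2 - b) / 2) * x ^+ 2)); last by field.
  have h : 0 <= b * (2 - b) by rewrite mulr_ge0//; lra.
  apply: mulr_ge0; first exact: mulr_ge0.
  have h1 : 0 <= 2 - a - b + b * (2 - b) / 2 by lra.
  by rewrite addr_ge0 ?divr_ge0 ?sqr_ge0// mulr_ge0 ?sqr_ge0.
have := le_trans (Vge _ _) (Vle n); lra.
Qed.

(** For [b <= 1], the bound [a u_n^2 <= 2] is added to [b u_n^2 <= 2 n], which comes from the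
    dissipation of a quadratic form; for [b > 1] the sequence stays in [-1, 1]. *)
Lemma lucas_sqr_le_linear (R : realFieldType) (a b : R) n :
  (0 < n)%N -> 0 <= a -> a <= 1 -> 0 <= b -> a + b <= 2 ->
  (a + b) * lucas (2 - a - b) (1 - b) n ^+ 2 <= 8 * n%:R.
Proof.
case: n => // n _ a_ge0 a_le1 b_ge0 ab_le2; set u := lucas _ _.
have uSS m : u m.+2 = (2 - a - b) * u m.+1 - (1 - b) * u m by [].
(* Lyapunov function in x = u_n and w = u_n - u_{n-1} for the case b <= 1. *)
pose W x w := (1 - a * b / 2) * w ^+ 2 - (1 - b) * a * x * w + (1 - b / 2) * a * x ^+ 2.
have n1 : 1 <= n.+1%:R :> R by rewrite ler1n.
have [b1|b1] := leP b 1; last first.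
  (* For b > 1, both coefficients of the recurrence are nonnegative and their
     sum is 1 - a, at most 1. *)
  have u1 m : `|u m| <= 1 /\ `|u m.+1| <= 1.
    elim: m => [|m [IH1 IH2]]; first by rewrite /u /lucas /= normr0 normr1 ler01.
    split=> //; rewrite uSS; move: IH1 IH2; rewrite !ler_norml.
    by move=> /andP[? ?] /andP[? ?]; apply/andP; split; nra.
  have := (u1 n).2; rewrite ler_norml => /andP[l1 l2].
  have : u n.+1 ^+ 2 <= 1 by nra.
  have := sqr_ge0 (u n.+1); nra.
have Wge x w : 0 <= W x w.
  have c1 : 0 < 1 - a * b / 2 by nra.
  (* Multiplying by the coefficient of [w ^+ 2] completes the square without division. The remainder
     is nonnegative because [1 / 4] dominates [(1 - b) ^+ 2 * a / 4]. *)
  rewrite -(pmulr_rge0 _ c1).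
  have -> : (1 - a * b / 2) * W x w = ((1 - a * b / 2) * w - (1 - b) * a / 2 * x) ^+ 2
    + a * ((1 - a * b / 2) * (1 - b / 2) - (1 - b) ^+ 2 * a / 4) * x ^+ 2 by rewrite /W; field.
  rewrite addr_ge0 ?sqr_ge0// mulr_ge0 ?sqr_ge0// mulr_ge0//.
  have : 2^-1 <= 1 - a * b / 2 by nra.
  have : 2^-1 <= 1 - b / 2 by nra.
  have : (1 - b) ^+ 2 <= 1 by nra.
  have := sqr_ge0 (1 - b); nra.
(* Each step costs [W] at least [b / 2] times a squared increment; as [W] starts at 1, [b] times the
   sum of these squares is at most [2 * (1 - W)]. *)
have step m : W (u m.+2) (u m.+2 - u m.+1) + b / 2 * (u m.+1 - u m) ^+ 2
    <= W (u m.+1) (u m.+1 - u m).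
  rewrite uSS; set x := u m.+1; set w := x - u m.
  have -> : u m = x - w by rewrite /w; ring.
  rewrite -subr_ge0 /W [leRHS](_ : _ = b * (1 - b + (1 - a) / 2) * w ^+ 2); last by field.
  by apply: mulr_ge0 (sqr_ge0 _); apply: mulr_ge0 => //; lra.
(* Cauchy-Schwarz on u_{m+1} = sum of the increments w, in inductive form. *)
have Wle m : b * u m.+1 ^+ 2 <=
    2 * m.+1%:R * (1 - W (u m.+2) (u m.+2 - u m.+1)).
  elim: m => [|m IH].
    have W1 : W (u 1) (u 1 - u 0) = 1 by rewrite /W /u /lucas /=; field.
    have := step 0%N; rewrite W1; set W2 := W _ _.
    rewrite (_ : u 1 = 1)// (_ : u 0 = 0)//; lra.
  have {}step := step m.+1; move: step IH; set w := _ - u m.+1.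
  rewrite (_ : u m.+2 = u m.+1 + w); last by rewrite /w; ring.
  set x := u m.+1; set W1 := W _ w; set W2 := W _ _ => step IH.
  have k_gt0 : 0 < m.+1%:R :> R by rewrite ltr0n.
  rewrite -(ler_pM2l k_gt0) -natr1; move: k_gt0 IH; set k := m.+1%:R => k_gt0 IH.
  (* Up to the factor [b], this is [(x + w)^2 / (k + 1) <= x^2 / k + w^2] cleared of
     denominators. *)
  have := mulr_ge0 b_ge0 (sqr_ge0 (x - k * w)).
  have : 0 <= k * (k + 1) * (W1 - (W2 + b / 2 * w ^+ 2)).
    by rewrite !mulr_ge0 ?subr_ge0// ?addr_ge0// ltW.
  have : 0 <= (k + 1) * (2 * k * (1 - W1) - b * x ^+ 2).
    by rewrite mulr_ge0 ?subr_ge0// addr_ge0// ltW.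
  lra.
have au2 : a * u n.+1 ^+ 2 <= 2 by exact: lucas_sqr_le.
have nW : 0 <= n.+1%:R * W (u n.+2) (u n.+2 - u n.+1) by exact: mulr_ge0.
have := Wle n; lra.
Qed.

(** * Isometric diagonalisation of a real symmetric matrix *)

Lemma map_Re_mulr (R : rcfType) m n p (A : 'M[R[i]]_(m, n)) (B : 'M[R]_(n, p)) :
  map_mx (@complex.Re R) (A *m map_mx (real_complex R) B) =
  map_mx (@complex.Re R) A *m B.
Proof.
apply/matrixP=> i j; rewrite !mxE (raddf_sum (@complex.Re R : Rcomplex R -> R)).
by apply: eq_bigr => k _; rewrite !mxE; case: (A i k) => x y /=; rewrite mulr0 subr0.
Qed.

Lemma map_Im_mulr (R : rcfType) m n p (A : 'M[R[i]]_(m, n)) (B : 'M[R]_(n, p)) :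
  map_mx (@complex.Im R) (A *m map_mx (real_complex R) B) =
  map_mx (@complex.Im R) A *m B.
Proof.
apply/matrixP=> i j; rewrite !mxE (raddf_sum (@complex.Im R : Rcomplex R -> R)).
by apply: eq_bigr => k _; rewrite !mxE; case: (A i k) => x y /=; rewrite mulr0 add0r.
Qed.

(* Stacking the real and imaginary parts of a unitary diagonalisation over R[i]
   trades the squareness of the change of basis for its being real. *)
Lemma symmetric_isometric_diag (R : rcfType) d (H : 'M[R]_d) : H^T = H ->
  exists (P : 'M[R]_(d + d, d)) (lam : 'rV[R]_(d + d)),
    P^T *m P = 1%:M /\ P *m H = diag_mx lam *m P.
Proof.
move=> Hsym; pose HC := map_mx (real_complex R) H.
have HCsym : HC \is symmetricmx.
  apply/is_hermitianmxP; rewrite expr0 scale1r map_mx_id//.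
  by rewrite /HC map_trmx Hsym.
have HCreal : HC \is a mxOver Num.real.
  by apply/mxOverP => i j; rewrite mxE; apply/complex_realP; exists (H i j).
have /orthomx_spectralP := symmetric_normalmx HCsym HCreal.
have := hermitian_spectral_diag_real (realsym_hermsym HCsym HCreal).
have := spectral_unitarymx HC; have := spectral_unit HC.
set P := spectralmx HC; set D := spectral_diag HC => Pu Pun Dreal HCE.
pose lam := map_mx (@complex.Re R) D.
have DE : D = map_mx (real_complex R) lam.
  apply/matrixP=> i j; rewrite !mxE.
  by have /complex_realP[k ->] := mxOverP Dreal i j.
have PH : P *m HC = diag_mx D *m P by rewrite HCE !mulmxA mulmxV// mul1mx.
pose A := map_mx (@complex.Re R) P; pose B := map_mx (@complex.Im R) P.
exists (col_mx A B), (row_mx lam lam); split.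
  rewrite tr_col_mx mul_row_col.
  (* The real part of the unitarity relation is [A^T *m A + B^T *m B = 1]. *)
  have /unitarymxP/mulmx1C := Pun => /matrixP PP.
  apply/matrixP => i j; have := congr1 (@complex.Re R) (PP i j).
  rewrite !mxE (raddf_sum (@complex.Re R : Rcomplex R -> R)).
  rewrite -big_split /=.
  rewrite (_ : complex.Re _ = (i == j)%:R); last by case: (i == j).
  by move=> <-; apply: eq_bigr => k _; rewrite !mxE; case: (P k i) => x y;
    case: (P k j) => z t /=; rewrite mulNr opprK.
(* As [HC] and [D] are real, [PH] splits into its real and imaginary parts. *)
rewrite mul_col_mx diag_mx_row mul_block_col !mul0mx addr0 add0r.
by congr col_mx; apply/matrixP => k j;
  [rewrite -map_Re_mulr | rewrite -map_Im_mulr]; rewrite PH DE !mul_diag_mx !mxE;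
  case: (P k j) => x y /=; rewrite !mul0r ?subr0 ?addr0.
Qed.

(** * Matrix recurrence *)

Definition quad (R : rcfType) d (B : 'M[R]_d) (x y : 'cV[R]_d) : R :=
  (x^T *m B *m y) 0 0.

Lemma sqnormE (R : rcfType) d (x : 'cV[R]_d) : sqnorm x = (x^T *m x) 0 0.
Proof. by rewrite mxE; apply: eq_bigr => i _; rewrite mxE expr2. Qed.

Definition lucas_mx (R : rcfType) d (H : 'M[R]_d) (alpha beta : R) : nat -> 'M[R]_d :=
  lucas (2%:M - alpha *: H - beta *: H) (1%:M - beta *: H).

Lemma mul_eigen_lucas_mx (R : rcfType) d (H : 'M[R]_d) (alpha beta h : R) (v : 'rV[R]_d) n :
  v *m H = h *: v ->
  v *m lucas_mx H alpha beta n =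
    lucas (2 - alpha * h - beta * h) (1 - beta * h) n *: v.
Proof.
move=> vH.
suff: v *m lucas_mx H alpha beta n =
    lucas (2 - alpha * h - beta * h) (1 - beta * h) n *: v /\
  v *m lucas_mx H alpha beta n.+1 =
    lucas (2 - alpha * h - beta * h) (1 - beta * h) n.+1 *: v by case.
elim: n => [|n [IH1 IH2]]; first by rewrite mulmx0 scale0r mulmx1 scale1r.
split=> //; rewrite /lucas_mx !lucasSS -!/(lucas_mx _ _ _) mulmxBr !mulmxA !mulmxBr.
rewrite mulmx1 -!scalemxAr vH mul_mx_scalar !mulmxBl -!scalemxAl IH1 IH2.
by rewrite !scalerA -!scalerBl; congr (_ *: v); ring.
Qed.

(** In the coordinates [P *m v] the form is diagonal and [sqnorm] is preserved, so the scalar bound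
    applies term by term. *)
Lemma quad_lucas_mx_le (R : rcfType) d (H : 'M[R]_d) (alpha beta c : R) n (v : 'cV[R]_d) :
  H^T = H ->
  (forall h, eigenvalue H h ->
     h * lucas (2 - alpha * h - beta * h) (1 - beta * h) n ^+ 2 <= c) ->
  quad H (lucas_mx H alpha beta n *m v) (lucas_mx H alpha beta n *m v) <=
  c * sqnorm v.
Proof.
move=> /symmetric_isometric_diag[P [lam [PP PH]]] hc.
have rowPH i : row i P *m H = lam 0 i *: row i P.
  by rewrite -row_mul PH; apply/rowP => j; rewrite mul_diag_mx !mxE.
have -> : sqnorm v = sqnorm (P *m v).
  by rewrite !sqnormE trmx_mul mulmxA -(mulmxA _ P^T) PP mulmx1.
set U := lucas_mx _ _ _ _.
have -> : quad H (U *m v) (U *m v) = \sum_i lam 0 i * (P *m U *m v) i 0 ^+ 2.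
  have -> : quad H (U *m v) (U *m v) =
      ((P *m U *m v)^T *m (diag_mx lam *m (P *m U *m v))) 0 0.
    by rewrite /quad -[H]mul1mx -PP -(mulmxA P^T) PH !trmx_mul !mulmxA.
  rewrite mxE; apply: eq_bigr => i _.
  rewrite mul_diag_mx; set x := P *m U *m v.
  by rewrite !mxE; ring.
rewrite /sqnorm mulr_sumr; apply: ler_sum => i _.
set u := lucas (2 - alpha * lam 0 i - beta * lam 0 i) (1 - beta * lam 0 i) n.
have -> : (P *m U *m v) i 0 = u * (P *m v) i 0.
  have := congr1 (fun r => (r *m v) 0 0) (mul_eigen_lucas_mx alpha beta n (rowPH i)).
  by rewrite -/U -scalemxAl -!row_mul !mxE.
(* A zero row of [P] does not exhibit [lam 0 i] as an eigenvalue, but its term vanishes. *)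
have [Pi0|Pi0] := eqVneq (row i P) 0.
  have -> : (P *m v) i 0 = 0.
    have : row i (P *m v) 0 0 = 0 by rewrite row_mul Pi0 mul0mx mxE.
    by rewrite [LHS]mxE.
  by rewrite mulr0 expr0n !mulr0.
rewrite exprMn mulrA ler_wpM2r ?sqr_ge0// hc//.
by apply/eigenvalueP; exists (row i P).
Qed.

(** Variation of constants: [g k] enters at time [k.+2] and then propagates like a fresh start from
    the values 0, 1 at times [k.+1], [k.+2]. *)
Lemma linear_recurrence_lucas (R : rcfType) d (p q : 'M[R]_d) (x : 'cV[R]_d)
    (e g : nat -> 'cV[R]_d) :
  e 0 = 0 -> e 1%N = x ->
  (forall n, e n.+2 = p *m e n.+1 - q *m e n + g n) ->
  forall n, e n = lucas p q n *m x + \sum_(k < n) lucas p q (n - k.+1) *m g k.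
Proof.
move=> e0 e1 eSS n.
pose s n := lucas p q n *m x + \sum_(k < n) lucas p q (n - k.+1) *m g k.
suff: e n = s n /\ e n.+1 = s n.+1 by case.
elim: n => [|n [IH1 IH2]].
  by rewrite e0 e1 /s big_ord0 big_ord1 !mul0mx mul1mx !addr0.
split=> //; rewrite eSS IH1 IH2 /s.
(* The top terms carry [U_0 = 0] or [U_1 = 1]; the latter yields [g n]. *)
do 3 rewrite big_ord_recr /=; rewrite !subnn subSnn !mul0mx !addr0 mul1mx.
rewrite [in RHS](eq_bigr (fun k : 'I_n => p *m (lucas p q (n.+1 - k.+1) *m g k)
   - q *m (lucas p q (n - k.+1) *m g k))); last first.
  move=> k _; have -> : (n.+2 - k.+1 = (n - k.+1).+2)%N by rewrite !subSS subSn ?subnSK// ltnW.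
  by rewrite subSS -(subnSK (ltn_ord k)) lucasSS mulmxBl -!mulmxA.
rewrite sumrB -!mulmx_sumr lucasSS mulmxBl -!mulmxA !mulmxDr.
by rewrite opprD addrACA -!addrA.
Qed.

Lemma noisy_step_scaled (R : rcfType) d (H : 'M[R]_d) ts alpha beta n (x y e : 'cV[R]_d) :
  n.+2%:R *: (noisy_step H ts alpha beta n.+1 x y e - ts) =
  (2%:M - alpha *: H - beta *: H) *m (n.+1%:R *: (x - ts))
  - (1%:M - beta *: H) *m (n%:R *: (y - ts)) + (n.+1%:R * alpha + beta) *: e.
Proof.
rewrite /noisy_step /= !mulmxBl -!scalemxAl mul1mx mul_scalar_mx -!scalemxAr.
set Hx := H *m _; set Hy := H *m (y - ts).
have n0 : n.+2%:R != 0 :> R by rewrite pnatr_eq0.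
apply/matrixP => i j; rewrite !mxE.
move: n0; rewrite -[n.+2%:R]natr1 -[n.+1%:R]natr1 => n0; field.
by rewrite addrC addrA in n0 *.
Qed.

Lemma noisy_theta_lucas (R : rcfType) d (H : 'M[R]_d) q alpha beta
    (eps : nat -> 'cV[R]_d) theta0 n :
  let ts := thstar H q in
  n%:R *: (noisy_theta H q alpha beta eps theta0 n - ts) =
  lucas_mx H alpha beta n *m (theta0 - ts) +
  \sum_(k < n) (k.+1%:R * alpha + beta) *: (lucas_mx H alpha beta (n - k.+1) *m eps k.+2).
Proof.
move=> ts; pose e m := m%:R *: (noisy_theta H q alpha beta eps theta0 m - ts).
rewrite -[LHS]/(e n) (@linear_recurrence_lucas _ _ (2%:M - alpha *: H - beta *: H)
  (1%:M - beta *: H) (theta0 - ts) e (fun k => (k.+1%:R * alpha + beta) *: eps k.+2)).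
- by congr (_ + _); apply: eq_bigr => k _; rewrite -scalemxAr.
- by rewrite /e scale0r.
- by rewrite /e scale1r.
- by move=> m; rewrite /e -noisy_step_scaled.
Qed.

Lemma quadf_thstar (R : rcfType) d (H : 'M[R]_d) (q x : 'cV[R]_d) :
  H^T = H -> H \in unitmx ->
  quadf H q x = 2^-1 * quad H (x - thstar H q) (x - thstar H q) + quadf H q (thstar H q).
Proof.
move=> Hsym Hu; have Hq : H *m thstar H q = q by rewrite mulKVmx.
set t := thstar H q in Hq *.
have qtE : q^T = t^T *m H by rewrite -[in LHS]Hq [LHS]trmx_mul Hsym.
have xq : (x^T *m H *m t) 0 0 = (q^T *m x) 0 0.
  by rewrite -mulmxA Hq !mxE; apply: eq_bigr => i _; rewrite !mxE mulrC.
rewrite /quadf /quad [(x - t)^T]linearB /= !mulmxBl !mulmxBr.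
have mxB (A B : 'M[R]_1) : (A - B) 0 0 = A 0 0 - B 0 0 by rewrite !mxE.
by rewrite !mxB xq qtE; field.
Qed.

Lemma posdef_unitmx (R : rcfType) d (H : 'M[R]_d) :
  (forall v : 'cV[R]_d, v != 0 -> 0 < (v^T *m H *m v) 0 0) -> H \in unitmx.
Proof.
move=> Hpos; rewrite -row_free_unit -kermx_eq0; apply/eqP/row_matrixP => i.
rewrite row0; apply: contraTeq isT => ri.
have := Hpos (row i (kermx H))^T; rewrite -trmx0 (inj_eq trmx_inj) => /(_ ri).
by rewrite trmxK -row_mul mulmx_ker row0 mul0mx mxE ltxx.
Qed.

Lemma posdef_eigenvalue_gt0 (R : rcfType) d (H : 'M[R]_d) h :
  (forall v : 'cV[R]_d, v != 0 -> 0 < (v^T *m H *m v) 0 0) ->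
  eigenvalue H h -> 0 < h.
Proof.
move=> Hpos /eigenvalueP[v vH v0].
have := Hpos v^T; rewrite -trmx0 (inj_eq trmx_inj) => /(_ v0).
rewrite trmxK vH -scalemxAl mxE; rewrite -[v in v *m _]trmxK -sqnormE => h_gt0.
have : 0 <= sqnorm v^T by apply: sumr_ge0 => i _; rewrite sqr_ge0.
rewrite le_eqVlt => /predU1P[s0|s_gt0]; last by rewrite -(pmulr_lgt0 _ s_gt0).
by move: h_gt0; rewrite -s0 mulr0 ltxx.
Qed.

(** * Expectation of quadratic forms in uncorrelated noise *)

Section Expectation.
Variables (R : rcfType) (Omega : Type) (V : pred (Omega -> R)) (E : (Omega -> R) -> R).
Hypotheses
  (V_cst : forall c : R, V (fun _ => c))
  (V_add : forall X Y, V X -> V Y -> V (fun w => X w + Y w))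
  (V_scale : forall (c : R) X, V X -> V (fun w => c * X w))
  (E_add : forall X Y, V X -> V Y -> E (fun w => X w + Y w) = E X + E Y)
  (E_scale : forall (c : R) X, V X -> E (fun w => c * X w) = c * E X)
  (E_one : E (fun _ => 1) = 1)
  (E_ge0 : forall X, V X -> (forall w, 0 <= X w) -> 0 <= E X).

Lemma E_cst c : E (fun _ => c) = c.
Proof.
rewrite (_ : (fun _ => c) = (fun w : Omega => c * (fun _ => 1) w)).
  by rewrite E_scale// E_one mulr1.
by apply/funext => w; rewrite mulr1.
Qed.

(** Integrability and value go together, since [E_add] asks for integrable partial sums. *)
Lemma E_sum (I : finType) (F : I -> Omega -> R) : (forall i, V (F i)) ->
  V (fun w => \sum_i F i w) /\ E (fun w => \sum_i F i w) = \sum_i E (F i).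
Proof.
move=> VF; elim: (index_enum I) => [|i s [Vs Es]].
  rewrite big_nil (_ : (fun _ => _) = fun=> 0); last by apply/funext => w; rewrite big_nil.
  by rewrite E_cst.
rewrite big_cons (_ : (fun _ => _) = fun w => F i w + \sum_(j <- s) F j w).
  by split; [exact: V_add | rewrite E_add ?Es].
by apply/funext => w; rewrite big_cons.
Qed.

Lemma E_linear d (u : 'rV[R]_d) (X : Omega -> 'cV[R]_d) :
  (forall i, V (fun w => X w i 0)) ->
  V (fun w => (u *m X w) 0 0) /\
  E (fun w => (u *m X w) 0 0) = \sum_i u 0 i * E (fun w => X w i 0).
Proof.
move=> VX; rewrite (_ : (fun _ => _) = fun w => \sum_i u 0 i * X w i 0).
  have [i|Vs ->] := E_sum (F := fun i w => u 0 i * X w i 0); first exact: V_scale.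
  by split=> //; apply: eq_bigr => i _; rewrite E_scale.
by apply/funext => w; rewrite mxE.
Qed.

Lemma E_bilinear d (B : 'M[R]_d) (X Y : Omega -> 'cV[R]_d) :
  (forall i j, V (fun w => X w i 0 * Y w j 0)) ->
  V (fun w => quad B (X w) (Y w)) /\
  E (fun w => quad B (X w) (Y w)) =
    \sum_i \sum_j B i j * E (fun w => X w i 0 * Y w j 0).
Proof.
move=> VXY.
rewrite (_ : (fun _ => _) = fun w => \sum_i \sum_j B i j * (X w i 0 * Y w j 0)).
  have Vij i j : V (fun w => B i j * (X w i 0 * Y w j 0)) by exact: V_scale.
  have [i|Vs ->] := E_sum (F := fun i w => \sum_j B i j * (X w i 0 * Y w j 0)).
    exact: (E_sum (Vij i)).1.
  split=> //; apply: eq_bigr => i _; rewrite (E_sum (Vij i)).2.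
  by apply: eq_bigr => j _; rewrite E_scale.
apply/funext => w; rewrite /quad mxE exchange_big; apply: eq_bigr => j _.
by rewrite mxE mulr_suml; apply: eq_bigr => i _; rewrite mxE; ring.
Qed.

Section Noise.
Variables (d : nat) (xi : nat -> Omega -> 'cV[R]_d) (C : 'M[R]_d).
Hypotheses
  (V_xi : forall n i, V (fun w => xi n w i 0))
  (V_xi2 : forall n m i j, V (fun w => xi n w i 0 * xi m w j 0))
  (E_xi : forall n i, E (fun w => xi n w i 0) = 0)
  (E_xi_uncorr : forall n m i j, n <> m -> E (fun w => xi n w i 0 * xi m w j 0) = 0)
  (E_xi_cov : forall n i j, E (fun w => xi n w i 0 * xi n w j 0) = C i j).

(* Apply E to the pointwise nonnegative c |xi|^2 - <xi, B xi>. *)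
Lemma E_quad_xi_le (B : 'M[R]_d) c n :
  (forall v, quad B v v <= c * sqnorm v) ->
  E (fun w => quad B (xi n w) (xi n w)) <= c * \tr C.
Proof.
move=> Bc; have [VB _] := E_bilinear B (V_xi2 n n).
have [V1 E1] := E_bilinear c%:M (V_xi2 n n).
have -> : c * \tr C = E (fun w => quad c%:M (xi n w) (xi n w)).
  rewrite E1 /mxtrace mulr_sumr; apply: eq_bigr => i _.
  rewrite (bigD1 i)//= E_xi_cov mxE eqxx mulr1n big1 ?addr0// => j ji.
  by rewrite mxE eq_sym (negbTE ji) mul0r.
rewrite -subr_ge0 -mulN1r -E_scale// -E_add//; last exact: V_scale.
apply: E_ge0 => [|w]; first by apply: V_add => //; exact: V_scale.
rewrite mulN1r subr_ge0 (le_trans (Bc _))// sqnormE /quad mul_mx_scalar.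
by rewrite -scalemxAl [leRHS]mxE.
Qed.

(** On expanding, the terms linear in the noise vanish by centering and the off-diagonal ones by
    uncorrelatedness. *)
Lemma E_quad_affine (B : 'M[R]_d) (a : 'cV[R]_d) N (A : nat -> 'M[R]_d) :
  V (fun w => quad B (a + \sum_(k < N) A k *m xi k w) (a + \sum_(k < N) A k *m xi k w)) /\
  E (fun w => quad B (a + \sum_(k < N) A k *m xi k w) (a + \sum_(k < N) A k *m xi k w)) =
  quad B a a + \sum_(k < N) E (fun w => quad ((A k)^T *m B *m A k) (xi k w) (xi k w)).
Proof.
(* Both cross terms; transposing the one with the noise on the left turns [B] into [B^T]. *)
pose l (k : 'I_N) w := (((a^T *m B *m A k) + (a^T *m B^T *m A k)) *m xi k w) 0 0.
pose b (k m : 'I_N) w := quad ((A k)^T *m B *m A m) (xi k w) (xi m w).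
rewrite (_ : (fun _ => _) = fun w => quad B a a + (\sum_k l k w + \sum_k \sum_m b k m w)).
  have Vl k : V (l k) by exact: (E_linear _ _).1.
  have Vb k m : V (b k m) by exact: (E_bilinear _ _).1.
  have El k : E (l k) = 0.
    by rewrite (E_linear _ _).2// big1// => i _; rewrite E_xi mulr0.
  have Eb k m : k != m -> E (b k m) = 0.
    move=> km; rewrite (E_bilinear _ _).2// big1// => i _; rewrite big1// => j _.
    by rewrite E_xi_uncorr ?mulr0// => /ord_inj/eqP; apply/negP.
  have Vbs k : V (fun w => \sum_m b k m w) by exact: (E_sum (Vb k)).1.
  have [Vls Els] := E_sum Vl; have [Vbss Ebss] := E_sum Vbs.
  split; first by apply: V_add (V_cst _) _; exact: V_add.
  rewrite E_add//; last exact: V_add.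
  rewrite E_cst E_add// Els big1 // add0r Ebss; congr (_ + _).
  apply: eq_bigr => k _; rewrite (E_sum (Vb k)).2 (bigD1 k)//= big1 ?addr0// => m mk.
  by rewrite Eb// eq_sym.
apply/funext => w; rewrite /l /b /quad.
have mxD (M M' : 'M[R]_1) : (M + M') 0 0 = M 0 0 + M' 0 0 by rewrite !mxE.
have tr00 (M : 'M[R]_1) : M^T 0 0 = M 0 0 by rewrite mxE.
rewrite [(a + _)^T]linearD /= linear_sum /= !mulmxDl !mulmxDr !mxD -!addrA; congr (_ + _).
rewrite !mulmx_sumr !mulmx_suml !summxE addrA -big_split /=; congr (_ + _).
  apply: eq_bigr => k _; rewrite mulmxDl mxD !mulmxA; congr (_ + _).
  by rewrite -[LHS]tr00 !trmx_mul !trmxK !mulmxA.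
rewrite [RHS]exchange_big /=; apply: eq_bigr => k _.
rewrite mulmx_suml summxE; apply: eq_bigr => m _.
by rewrite trmx_mul !mulmxA.
Qed.

End Noise.
End Expectation.

(** * Bounds on the expected optimality gap *)

Theorem theorem3 (R : rcfType) (d : nat) (H : 'M[R]_d) (q : 'cV[R]_d) (L : R)
  (* probability space: sample type, a space V of integrable real random
     variables (a vector space containing constants) and the expectation E *)
  (Omega : Type) (V : pred (Omega -> R)) (E : (Omega -> R) -> R)
  (eps : nat -> Omega -> 'cV[R]_d) (C : 'M[R]_d)
  (theta0 : 'cV[R]_d) (alpha beta : R) (N : nat) :
  (* H symmetric positive definite with largest eigenvalue L *)
  H^T = H ->
  (forall v : 'cV[R]_d, v != 0 -> 0 < (v^T *m H *m v) 0 0) ->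
  eigenvalue H L ->
  (forall mu, eigenvalue H mu -> mu <= L) ->
  (* integrable random variables and expectation *)
  (forall c : R, V (fun _ => c)) ->
  (forall X Y, V X -> V Y -> V (fun w => X w + Y w)) ->
  (forall (c : R) X, V X -> V (fun w => c * X w)) ->
  (forall X Y, V X -> V Y -> E (fun w => X w + Y w) = E X + E Y) ->
  (forall (c : R) X, V X -> E (fun w => c * X w) = c * E X) ->
  E (fun _ => 1) = 1 ->
  (forall X, V X -> (forall w, 0 <= X w) -> 0 <= E X) ->
  (* noise: square integrable, centered, uncorrelated, covariance C (PSD) *)
  (forall n i, V (fun w => eps n w i 0)) ->
  (forall n m i j, V (fun w => eps n w i 0 * eps m w j 0)) ->
  (forall n i, (2 <= n)%N -> E (fun w => eps n w i 0) = 0) ->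
  (forall n m i j, (2 <= n)%N -> (2 <= m)%N -> n <> m ->
     E (fun w => eps n w i 0 * eps m w j 0) = 0) ->
  (forall n i j, (2 <= n)%N -> E (fun w => eps n w i 0 * eps n w j 0) = C i j) ->
  (forall v : 'cV[R]_d, 0 <= (v^T *m C *m v) 0 0) ->
  (* parameters *)
  (1 <= N)%N ->
  0 <= alpha -> alpha <= L^-1 ->
  0 <= beta -> beta <= 2 / L - alpha ->
  let ts := thstar H q in
  let gap := E (fun w => quadf H q (noisy_theta H q alpha beta (fun n => eps n w) theta0 N))
             - quadf H q ts in
  let D := sqnorm (theta0 - ts) in
  let Nr := N%:R in
  (0 < alpha ->
     gap <= D / (alpha * Nr ^+ 2) + (alpha * Nr + beta) ^+ 2 / (alpha * Nr) * \tr C) /\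
  (0 < alpha + beta ->
     gap <= 4 * D / ((alpha + beta) * Nr) + 4 * (alpha * Nr + beta) ^+ 2 / (alpha + beta) * \tr C).
Proof.
move=> Hsym Hpos HL HLmax V_cst V_add V_scale E_add E_scale E_one E_ge0 V_eps V_eps2
  E_eps E_uncorr E_cov _ N_gt0 alpha_ge0 alpha_le beta_ge0 beta_le ts gap D Nr.
have mxZ c (M : 'M[R]_1) : (c *: M) 0 0 = c * M 0 0 by rewrite mxE.
have L_gt0 := posdef_eigenvalue_gt0 Hpos HL.
have Nr_gt0 : 0 < Nr by rewrite ltr0n.
(* The noise is reindexed from 0, which discharges the conditions [2 <= n]. *)
pose xi k w := eps k.+2 w.
have V_xi n i : V (fun w => xi n w i 0) by exact: V_eps.
have V_xi2 n m i j : V (fun w => xi n w i 0 * xi m w j 0) by exact: V_eps2.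
have E_xi n i : E (fun w => xi n w i 0) = 0 by exact: E_eps.
have E_xiC n i j : E (fun w => xi n w i 0 * xi n w j 0) = C i j by exact: E_cov.
have E_xi_uncorr n m i j : n <> m -> E (fun w => xi n w i 0 * xi m w j 0) = 0.
  by move=> nm; apply: E_uncorr => // -[].
pose A k := (k.+1%:R * alpha + beta) *: lucas_mx H alpha beta (N - k.+1).
pose a := lucas_mx H alpha beta N *m (theta0 - ts).
have gapE : gap = (2 * Nr ^+ 2)^-1 * (quad H a a +
    \sum_(k < N) E (fun w => quad ((A k)^T *m H *m A k) (xi k w) (xi k w))).
  have [VQ EQ] := E_quad_affine V_cst V_add V_scale E_add E_scale E_one
    V_xi V_xi2 E_xi E_xi_uncorr H a N A.
  rewrite /gap -EQ; apply/eqP; rewrite subr_eq; apply/eqP.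
  rewrite -E_scale// -[X in _ + X](E_cst V_cst E_scale E_one) -E_add//; last exact: V_scale.
  congr E; apply/funext => w; rewrite quadf_thstar ?posdef_unitmx// -/ts; congr (_ + _).
  have <- : Nr *: (noisy_theta H q alpha beta (fun n => eps n w) theta0 N - ts) =
      a + \sum_(k < N) A k *m xi k w.
    rewrite noisy_theta_lucas -/ts; congr (_ + _); apply: eq_bigr => k _.
    by rewrite /A -scalemxAl.
  rewrite /quad [(Nr *: _)^T]linearZ /= -!scalemxAl -scalemxAr !mxZ.
  by field; rewrite gt_eqF.
(* The constant is uniform in [n <= N], as the noises involve every [N - k.+1]; each of their [N]
   weights is at most [alpha * Nr + beta]. *)
have gap_le c : 0 <= c ->
    (forall n h, (n <= N)%N -> eigenvalue H h ->
      h * lucas (2 - alpha * h - beta * h) (1 - beta * h) n ^+ 2 <= c) ->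
    gap <= (2 * Nr ^+ 2)^-1 * (c * D + Nr * (alpha * Nr + beta) ^+ 2 * c * \tr C).
  move=> c_ge0 hc; rewrite gapE ler_wpM2l//.
    by rewrite invr_ge0 mulr_ge0// sqr_ge0.
  apply: lerD; first by apply: quad_lucas_mx_le => // h; exact: hc.
  set s := (alpha * Nr + beta) ^+ 2.
  have -> : Nr * s * c * \tr C = \sum_(k < N) s * c * \tr C.
    by rewrite sumr_const card_ord -mulr_natl !mulrA.
  apply: ler_sum => k _.
  apply: (E_quad_xi_le V_cst V_add V_scale E_add E_scale E_one E_ge0 V_xi2 E_xiC) => v.
  have -> : quad ((A k)^T *m H *m A k) v v = (k.+1%:R * alpha + beta) ^+ 2 *
      quad H (lucas_mx H alpha beta (N - k.+1) *m v) (lucas_mx H alpha beta (N - k.+1) *m v).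
    rewrite /quad /A [(_ *: _)^T]linearZ /= trmx_mul -!scalemxAl -scalemxAr -!scalemxAl.
    by rewrite !mxZ !mulmxA -scalemxAr -scalemxAl mxZ mulrA expr2.
  have ck : 0 <= k.+1%:R * alpha + beta by rewrite addr_ge0// mulr_ge0.
  rewrite -mulrA; apply: (@le_trans _ _ ((k.+1%:R * alpha + beta) ^+ 2 * (c * sqnorm v))).
    rewrite ler_wpM2l ?sqr_ge0//; apply: quad_lucas_mx_le => // h.
    by apply: hc; rewrite leq_subr.
  rewrite ler_wpM2r ?mulr_ge0//; first by apply: sumr_ge0 => i _; exact: sqr_ge0.
  rewrite ler_sqr ?nnegrE//; last by rewrite addr_ge0// mulr_ge0// ltW.
  by rewrite lerD2r mulrC ler_wpM2l// ler_nat.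
(* The step-size conditions at [L] pass to every smaller eigenvalue. *)
have ab_eig h : eigenvalue H h ->
    [/\ 0 < h, alpha * h <= 1, 0 <= alpha * h, 0 <= beta * h & alpha * h + beta * h <= 2].
  move=> hH; have h_gt0 := posdef_eigenvalue_gt0 Hpos hH; have hL := HLmax _ hH.
  have := ler_wpM2l alpha_ge0 hL; have := ler_wpM2l beta_ge0 hL.
  have : alpha * L <= 1 by rewrite -ler_pdivlMr// div1r.
  have : (alpha + beta) * L <= 2 by rewrite -ler_pdivlMr// addrC -lerBrDr.
  split=> //; try lra; by rewrite mulr_ge0// ltW.
split=> [alpha_gt0|ab_gt0].
- apply: le_trans (gap_le (2 / alpha) _ _) _.
  + by rewrite divr_ge0.
  + move=> n h _ /ab_eig[h_gt0 ? ? ? ?].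
    by rewrite ler_pdivlMr// mulrC mulrA lucas_sqr_le.
  + rewrite le_eqVlt; apply/orP; left; apply/eqP; field.
    by rewrite !gt_eqF.
(* The bound [8 n] is relaxed to [8 N] to make the constant independent of [n]. *)
apply: le_trans (gap_le (8 * Nr / (alpha + beta)) _ _) _.
- by rewrite divr_ge0 ?mulr_ge0 ?ltW.
- move=> n h nN /ab_eig[h_gt0 ? ? ? ?].
  rewrite ler_pdivlMr// mulrC mulrA mulrDl.
  case: n nN => [|n] nN.
    by rewrite /lucas expr0n mulr0 mulr_ge0// ltW.
  apply: le_trans (lucas_sqr_le_linear _ _ _ _ _) _ => //.
  by rewrite ler_wpM2l// ler_nat.
rewrite le_eqVlt; apply/orP; left; apply/eqP; field.
by rewrite !gt_eqF.
Qed.
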